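(* Let $k,s\geq 2$ be integers. There exists a constant $C=C_{k,s}>0$ such that the following holds. Let $G$ be a graph on $n$ vertices which contains no copy of $K_{s,s}$ as a subgraph, and let $V(G)=A\cup B$ be a partition with at least $e(A,B)\geq Cn^{1+1/k}$ edges between $A$ and $B$. Then $G$ contains an induced cycle of length $2k$ on vertices $v_1,v_2,\dots,v_{2k}$ (in cyclic order) with $v_1,v_3,\dots,v_{2k-1}\in A$ and $v_2,v_4,\dots,v_{2k}\in B$. *)

(* Defs.v *)
From mathcomp Require Import all_boot.
From Stdlib Require Import Reals.
Set Implicit Arguments. Unset Strict Implicit. Unset Printing Implicit Defensive.

Definition simple_graph (T : finType) (e : rel T) : Prop :=
  symmetric e /\ irreflexive e.

Definition has_Kss (T : finType) (e : rel T) (s : nat) : Prop :=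
  exists X Y : {set T},
    [/\ #|X| = s, #|Y| = s, [disjoint X & Y] &
        forall x y, x \in X -> y \in Y -> e x y].

(* e(A,B): number of edges with one endpoint in A and one in B (A, B disjoint). *)
Definition edges_between (T : finType) (e : rel T) (A B : {set T}) : nat :=
  #|[set p : T * T | [&& p.1 \in A, p.2 \in B & e p.1 p.2]]|.

Definition induced_cycle (T : finType) (e : rel T) (m : nat) (v : 'I_m -> T) : Prop :=
  injective v /\
  forall i j : 'I_m, e (v i) (v j) = ((j == (i.+1 %% m) :> nat) || (i == (j.+1 %% m) :> nat)).

(* Main.v *)
Require Import Defs.
From mathcomp Require Import all_boot all_order all_algebra realalg.
From mathcomp Require Import ring lra zify.

(** Pass to a subgraph H of G[A, B] of minimum degree d >= c n^(1/k) and let N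
    be its normalised adjacency matrix. The closed walks of length 2k in H,
    weighted by N, have total weight tr N^(2k) >= 1. The diagonal entries of the
    powers N^(2p) form a log-convex sequence in p, so pairs of k-walks with
    common endpoints x, z that agree at a given inner position have total weight
    at most d^(-1) tr N^(2k-2) <= (n^(1/k) / d) tr N^(2k), a small fraction.
    For non-consecutive positions i, j of a closed walk choose antipodal
    positions separating them. With the vertices x, z there fixed, v_i and v_j
    are independent, and if neither distribution concentrates, then G being
    K_{s,s}-free makes adjacency of v_i and v_j unlikely; concentration, as well
    as v_i = v_j, is controlled by the collisions above. A union bound over
    (i, j) leaves a closed walk that is an induced cycle. *)

Set Implicit Arguments. Unset Strict Implicit. Unset Printing Implicit Defensive.
Import Order.TTheory GRing.Theory Num.Theory.

(** * Finite sums *)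

Section FiniteSums.
Local Open Scope ring_scope.
Variables (F : realFieldType) (I : finType).
Implicit Types a b f g : I -> F.

Lemma mulr_sum2 (J : finType) a (b : J -> F) :
  (\sum_i a i) * (\sum_j b j) = \sum_i \sum_j a i * b j.
Proof. by rewrite mulr_suml; apply: eq_bigr => i _; rewrite mulr_sumr. Qed.

(** Lagrange's identity: twice the difference of the two sides is the sum of the squares
    [(a i * b j - a j * b i) ^+ 2]. *)
Lemma cauchy_schwarz a b :
  (\sum_i a i * b i) ^+ 2 <= (\sum_i a i ^+ 2) * (\sum_i b i ^+ 2).
Proof.
have h : 0 <= \sum_i \sum_j (a i * b j - a j * b i) ^+ 2.
  by apply: sumr_ge0 => i _; apply: sumr_ge0 => j _; apply: sqr_ge0.
have e : \sum_i \sum_j (a i * b j - a j * b i) ^+ 2 =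
   ((\sum_i a i ^+ 2) * (\sum_i b i ^+ 2)
    + (\sum_i b i ^+ 2) * (\sum_i a i ^+ 2))
   - (\sum_i a i * b i) ^+ 2 *+ 2.
  rewrite expr2 !mulr_sum2 -big_split /= -sumrMnl -sumrB; apply: eq_bigr => i _.
  rewrite -big_split /= -sumrMnl -sumrB; apply: eq_bigr => j _; ring.
move: h; rewrite e; lra.
Qed.

Lemma le_sum_sqr_subset (S : {set I}) g :
  (\sum_(i in S) g i) ^+ 2 <= #|S|%:R * \sum_i g i ^+ 2.
Proof.
have -> : \sum_(i in S) g i = \sum_i (i \in S)%:R * g i.
  by rewrite big_mkcond; apply: eq_bigr => i _; case: ifP; rewrite ?mul1r ?mul0r.
apply: le_trans (cauchy_schwarz _ _) _.
suff -> : \sum_i ((i \in S)%:R : F) ^+ 2 = #|S|%:R by [].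
rewrite -sum1_card natr_sum [RHS]big_mkcond /=; apply: eq_bigr => i _.
by case: ifP; rewrite ?expr1n ?expr0n.
Qed.

(** Induction on [n] through Chebyshev's sum inequality [cheb]: [a] and [a ^+ m] are similarly
    ordered, so every product of differences is nonnegative. *)
Lemma weighted_power_mean g a n :
  (forall i, 0 <= g i) -> (forall i, 0 <= a i) ->
  (\sum_i g i * a i) ^+ n.+1 <= (\sum_i g i) ^+ n * \sum_i g i * a i ^+ n.+1.
Proof.
move=> g0 a0; have w0 : 0 <= \sum_i g i by apply: sumr_ge0.
have cheb m : (\sum_i g i * a i) * (\sum_i g i * a i ^+ m) <=
   (\sum_i g i) * \sum_i g i * a i ^+ m.+1.
  have h : 0 <= \sum_i \sum_j g i * g j * ((a i - a j) * (a i ^+ m - a j ^+ m)).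
    apply: sumr_ge0 => i _; apply: sumr_ge0 => j _.
    apply: mulr_ge0; first exact: mulr_ge0.
    case: (leP (a i) (a j)) => le.
      by rewrite mulr_le0 // subr_le0 // lerXn2r ?nnegrE.
    by rewrite mulr_ge0 // subr_ge0 ?lerXn2r ?nnegrE // ltW.
  have e : \sum_i \sum_j g i * g j * ((a i - a j) * (a i ^+ m - a j ^+ m)) =
     ((\sum_i g i * a i ^+ m.+1) * (\sum_i g i)
      + (\sum_i g i) * (\sum_i g i * a i ^+ m.+1))
     - ((\sum_i g i * a i) * (\sum_i g i * a i ^+ m)
       + (\sum_i g i * a i ^+ m) * (\sum_i g i * a i)).
    rewrite !mulr_sum2 -!big_split /= -sumrB; apply: eq_bigr => i _.
    rewrite -!big_split /= -sumrB; apply: eq_bigr => j _; rewrite !exprS; ring.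
  move: h; rewrite e; lra.
have ga0 m : 0 <= \sum_i g i * a i ^+ m.
  by apply: sumr_ge0 => i _; rewrite mulr_ge0 ?exprn_ge0.
elim: n => [|n IHn]; first by rewrite !expr1 expr0 mul1r.
rewrite exprS; apply: le_trans (_ : (\sum_i g i * a i) *
   ((\sum_i g i) ^+ n * (\sum_i g i * a i ^+ n.+1)) <= _).
  by apply: ler_wpM2l => //; apply: sumr_ge0 => i _; rewrite mulr_ge0.
rewrite mulrCA [X in _ <= X * _]exprSr -mulrA.
by apply: ler_wpM2l; rewrite ?exprn_ge0.
Qed.

Lemma sum_prod_coincidence f n (i j : 'I_n) : i != j ->
  \sum_(u : {ffun 'I_n -> I} | u i == u j) \prod_l f (u l) =
  (\sum_x f x) ^+ (n - 2) * \sum_x f x ^+ 2.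
Proof.
(* The factor [c x l] forces the value [x] at the positions [i] and [j]. Summing over the common
   value [x] turns the constraint into a sum of products, which factors over the positions. *)
move=> ij; pose c x (l : 'I_n) y := f y *+ ((l \in [set i; j]) ==> (y == x)).
have -> : \sum_(u : {ffun 'I_n -> I} | u i == u j) \prod_l f (u l) =
    \sum_x \sum_(u : {ffun 'I_n -> I}) \prod_l c x l (u l).
  rewrite exchange_big big_mkcond /=; apply: eq_bigr => u _.
  rewrite (bigD1 (u i)) //= [X in _ = _ + X]big1 ?addr0 => [|x xu].
    case: eqP => [uij|uij].
      apply: eq_bigr => l _; rewrite /c in_set2.
      case: (l =P i) => [->|_]; first by rewrite eqxx.
      by case: (l =P j) => [->|_] //=; rewrite uij eqxx.
    rewrite (bigD1 j) //= /c in_set2 eqxx orbT /=.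
    by case: eqP => [/esym//|_]; rewrite mul0r.
  by rewrite (bigD1 i) //= /c in_set2 eqxx /= eq_sym (negPf xu) mul0r.
rewrite mulr_sumr; apply: eq_bigr => x _.
rewrite -(bigA_distr_bigA (c x)) (bigD1 i) //= (bigD1 j) 1?eq_sym //=.
have cE l : l \in [set i; j] -> \sum_y c x l y = f x.
  move=> lij; rewrite (bigD1 x) //= big1 => [|y yx].
    by rewrite /c lij eqxx addr0.
  by rewrite /c lij (negPf yx).
rewrite !cE ?in_set2 ?eqxx ?orbT // mulrA -expr2 mulrC; congr (_ * _).
rewrite (eq_bigr (fun=> \sum_x f x)) => [|l /andP[li lj]]; last first.
  by apply: eq_bigr => y _; rewrite /c in_set2 (negPf li) (negPf lj).
rewrite prodr_const; congr (_ ^+ _).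
have := cardsC [set i; j]; rewrite cards2 ij card_ord => /esym nE.
rewrite [in RHS]nE addKn; apply: eq_card => l; by rewrite !inE negb_or.
Qed.

End FiniteSums.

(** * Weighted Kovari-Sos-Turan inequality *)

Section WeightedKovariSosTuran.
Local Open Scope ring_scope.
Variables (F : realFieldType) (T : finType) (e : rel T) (s : nat).
Hypotheses (e_irr : irreflexive e) (noK : ~ has_Kss e s).

(** Otherwise [s] common neighbours and the image of [u] form a [K_{s,s}]; the two sides are
    disjoint because [e] is irreflexive. *)
Lemma card_common_neighbours (u : {ffun 'I_s -> T}) : injective u ->
  (#|[set y | [forall i, e (u i) y]]| <= s)%N.
Proof.
move=> inj; rewrite leqNgt; apply/negP => lt.
have [Y /andP[/subsetP sub /eqP cY]] :
    exists Y : {set T}, (Y \subset [set y | [forall i, e (u i) y]]) && (#|Y| == s).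
  have := cards_draws [set y | [forall i, e (u i) y]] s.
  move=> h; have : (0 < 'C(#|[set y | [forall i, e (u i) y]]|, s))%N.
    by rewrite bin_gt0 ltnW.
  by rewrite -h => /card_gt0P[Y]; rewrite inE => ?; exists Y.
have adj x y : x \in [set u i | i in 'I_s] -> y \in Y -> e x y.
  by move=> /imsetP[i _ ->] /sub; rewrite inE => /forallP/(_ i).
apply: noK; exists [set u i | i in 'I_s], Y; split=> //.
  by rewrite card_imset // card_ord.
rewrite -setI_eq0; apply/set0Pn => -[x /setIP[xX xY]].
by have := adj _ _ xX xY; rewrite e_irr.
Qed.

(* Sampling s points from f, either two of them coincide or their common
   neighbourhood has at most s elements, hence small g-weight. *)
Lemma weighted_kst (f g : T -> F) (w : F) (q : nat) :
  (0 < q)%N ->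
  (forall x, 0 <= f x) -> (forall x, 0 <= g x) ->
  \sum_x f x = w -> \sum_x g x = w ->
  \sum_x \sum_y f x * g y * (e x y)%:R <=
  q%:R^-1 * w ^+ 2
  + (2 * s ^ 2 * q ^ (2 * s))%:R * (\sum_x f x ^+ 2 + \sum_x g x ^+ 2).
Proof.
move=> q0 f0 g0 fw gw.
set B := \sum_x _; set F2 := \sum_x f x ^+ 2; set G2 := \sum_x g x ^+ 2.
have w0 : 0 <= w by rewrite -fw sumr_ge0.
have F20 : 0 <= F2 by apply: sumr_ge0 => x _; apply: sqr_ge0.
have G20 : 0 <= G2 by apply: sumr_ge0 => x _; apply: sqr_ge0.
have q0' : 0 < q%:R :> F by rewrite ltr0n.
set K := (2 * s ^ 2 * q ^ (2 * s))%N.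
have K0 : 0 <= K%:R * (F2 + G2) by rewrite mulr_ge0 ?ler0n ?addr_ge0.
have Bw : B <= w ^+ 2.
  rewrite expr2 -{1}fw -gw mulr_sum2; apply: ler_sum => x _; apply: ler_sum => y _.
  by rewrite ler_piMr ?mulr_ge0 // lern1 leq_b1.
(* If [B] exceeds the first term, then [w ^+ 2 < q%:R * B], and the second term alone is shown to
   dominate [w ^+ 2], hence [B]. *)
case: (lerP B (q%:R^-1 * w ^+ 2)) => [le|lt].
  by apply: le_trans le _; rewrite lerDl.
suff : w ^+ 2 <= K%:R * (F2 + G2).
  move=> h; apply: le_trans Bw _; apply: le_trans h _; rewrite lerDr.
  by rewrite mulr_ge0 ?sqr_ge0 // invr_ge0 ltW.
have wlt : w ^+ 2 < q%:R * B by rewrite mulrC -ltr_pdivrMr // mulrC.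
have {Bw lt} wp : 0 < w.
  rewrite lt_def w0 andbT; apply/eqP => w_0.
  by move: lt Bw; rewrite w_0 expr0n /= mulr0 => /lt_le_trans h /h; rewrite ltxx.
pose a y := \sum_x f x * (e x y)%:R.
have a0 y : 0 <= a y by apply: sumr_ge0 => x _; rewrite mulr_ge0 ?ler0n.
have BE : B = \sum_y g y * a y.
  rewrite /B exchange_big /=; apply: eq_bigr => y _; rewrite mulr_sumr.
  by apply: eq_bigr => x _; ring.
have [s0|s_gt0] := posnP s.
  case: noK; rewrite s0; exists set0, set0; split; rewrite ?cards0 ?disjoints0 //.
    by rewrite -setI_eq0 set0I.
  by move=> x y; rewrite inE.
(* [b u] is the [g]-weight of the common neighbourhood of the sample [u]. *)
pose b (u : {ffun 'I_s -> T}) := \sum_y g y * \prod_i (e (u i) y)%:R.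
have b0 u : 0 <= b u.
  apply: sumr_ge0 => y _; rewrite mulr_ge0 //; apply: prodr_ge0 => i _.
  exact: ler0n.
have aE : \sum_y g y * a y ^+ s = \sum_(u : {ffun 'I_s -> T}) \prod_i f (u i) * b u.
  rewrite (eq_bigr (fun y => \sum_(u : {ffun 'I_s -> T})
     \prod_i f (u i) * (g y * \prod_i (e (u i) y)%:R))) => [|y _]; last first.
    have -> : a y ^+ s = \prod_(i < s) a y by rewrite prodr_const card_ord.
    rewrite /a bigA_distr_bigA mulr_sumr; apply: eq_bigr => u _.
    by rewrite big_split /=; ring.
  by rewrite exchange_big; apply: eq_bigr => u _; rewrite -mulr_sumr.
have bw u : b u <= w.
  rewrite -gw; apply: ler_sum => y _; rewrite ler_piMr // prodr_ile1 // => i _.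
  by rewrite ler0n lern1 leq_b1.
have fu0 (u : {ffun 'I_s -> T}) : 0 <= \prod_i f (u i) by apply: prodr_ge0.
pose Q : F := q%:R ^+ s.
have Q0 : 0 < Q by rewrite exprn_gt0.
(* Expanding [(w - Q * b u) ^+ 2 >= 0] bounds [w * b u] by [(Q^-1 * w ^+ 2 + Q * b u ^+ 2) / 2], and
   [b u ^+ 2 <= s%:R * G2] for injective [u]. The scale [Q] makes [Q * c] contain exactly half of
   [w ^+ 2]. *)
pose c := (Q^-1 * w ^+ 2 + s%:R * Q * G2) / 2.
have b_inj (u : {ffun 'I_s -> T}) : injectiveb u -> w * b u <= c.
  move=> /injectiveP inj.
  have bE : b u = \sum_(y in [set y | [forall i, e (u i) y]]) g y.
    rewrite /b [RHS]big_mkcond; apply: eq_bigr => y _; rewrite inE.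
    case: forallP => [h|/forallP]; first by rewrite big1 ?mulr1 // => i _; rewrite h.
    rewrite negb_forall => /existsP[i /negPf h].
    by rewrite (bigD1 i) //= h mul0r mulr0.
  have b2 : b u ^+ 2 <= s%:R * G2.
    rewrite bE; apply: le_trans (le_sum_sqr_subset _ _) _.
    by rewrite ler_wpM2r // ler_nat card_common_neighbours.
  have h : 0 <= (w - Q * b u) ^+ 2 by apply: sqr_ge0.
  rewrite /c ler_pdivlMr ?ltr0n // -(ler_pM2l Q0).
  have -> : Q * (Q^-1 * w ^+ 2 + s%:R * Q * G2) = w ^+ 2 + Q ^+ 2 * (s%:R * G2).
    by field; rewrite gt_eqF.
  have := ler_wpM2l (ltW (exprn_gt0 2 Q0)) b2.
  by move: h; lra.
(* Samples with a repetition are bounded by a union over ordered pairs of positions together with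
   [b u <= w]; injective ones by [b u <= c / w]. *)
have main : B ^+ s <= w ^+ s.-1 * ((s ^ 2)%:R * w ^+ s.-1 * F2 + w ^+ s.-1 * c).
  rewrite BE -(prednK s_gt0); apply: le_trans (weighted_power_mean _ g0 a0) _.
  rewrite gw (prednK s_gt0) ler_wpM2l ?exprn_ge0 // aE (bigID (fun u : {ffun 'I_s -> T} => injectiveb u)) /= addrC.
  apply: lerD.
    apply: le_trans (_ : \sum_(u : {ffun 'I_s -> T} | ~~ injectiveb u) \prod_i f (u i) * w <= _).
      by apply: ler_sum => u _; rewrite ler_wpM2l.
    rewrite -mulr_suml.
    apply: le_trans (_ : (\sum_(p : 'I_s * 'I_s | p.1 != p.2)
       \sum_(u : {ffun 'I_s -> T} | u p.1 == u p.2) \prod_i f (u i)) * w <= _).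
      rewrite ler_wpM2r //.
      rewrite (exchange_big_dep predT) //= big_mkcond /=; apply: ler_sum => u _.
      case: ifP => [|_]; last by apply: sumr_ge0.
      move=> /injectivePn[i [j ij uij]].
      by rewrite (bigD1 (i, j)) /= ?ij ?uij ?eqxx // lerDl sumr_ge0.
    (* For [s = 1] there is no pair of distinct positions; from [s = 2] on the truncated [s - 2] is
       the true difference. *)
    have [s1|s1] := ltnP 1 s; last first.
      rewrite big_pred0 => [|[i j]] /=; first by rewrite mul0r !mulr_ge0 ?exprn_ge0.
      apply/negbTE; rewrite negbK -val_eqE /=.
      by have := ltn_ord i; have := ltn_ord j; lia.
    rewrite (eq_bigr (fun=> w ^+ (s - 2) * F2)) => [|p pP]; last first.
      by rewrite sum_prod_coincidence // fw.
    rewrite sumr_const; set m := #|_|.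
    have -> : w ^+ (s - 2) * F2 *+ m * w = m%:R * (w ^+ (s - 2).+1 * F2).
      by rewrite exprS -mulr_natl; ring.
    have -> : (s - 2).+1 = s.-1 by lia.
    rewrite -mulrA ler_wpM2r ?mulr_ge0 ?exprn_ge0 // ler_nat.
    by apply: leq_trans (max_card _) _; rewrite card_prod card_ord.
  have cc0 : 0 <= c.
    by rewrite !(mulr_ge0, addr_ge0) ?invr_ge0 ?ler0n ?sqr_ge0 // ltW.
  apply: le_trans (_ : \sum_(u : {ffun 'I_s -> T} | injectiveb u) \prod_i f (u i) * (c / w) <= _).
    apply: ler_sum => u uinj; rewrite ler_wpM2l // ler_pdivlMr // mulrC.
    exact: b_inj.
  apply: le_trans (_ : \sum_(u : {ffun 'I_s -> T}) \prod_i f (u i) * (c / w) <= _).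
    rewrite [leLHS]big_mkcond /=; apply: ler_sum => u _; case: ifP => // _.
    by rewrite mulr_ge0 // divr_ge0.
  rewrite -mulr_suml -(bigA_distr_bigA (fun (i : 'I_s) y => f y)) /= fw.
  rewrite prodr_const card_ord -{1}(prednK s_gt0) exprS le_eqVlt.
  by apply/orP; left; apply/eqP; field; rewrite gt_eqF.
have wB : w ^+ (2 * s) <= Q * B ^+ s.
  by rewrite exprM -exprMn lerXn2r ?nnegrE ?sqr_ge0 ?(ltW wlt) // (le_trans (sqr_ge0 w)) // ltW.
have : w ^+ 2 <= Q * ((s ^ 2)%:R * F2 + c).
  rewrite -(ler_pM2l (exprn_gt0 (2 * s.-1) wp)) -exprD.
  have -> : (2 * s.-1 + 2 = 2 * s)%N by lia.
  apply: le_trans wB _; rewrite mulrCA ler_pM2l //.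
  apply: le_trans main _; rewrite mul2n -addnn exprD le_eqVlt; apply/orP; left.
  by apply/eqP; ring.
have -> : Q * ((s ^ 2)%:R * F2 + c) = Q * (s ^ 2)%:R * F2 + w ^+ 2 / 2 + s%:R * Q ^+ 2 * G2 / 2.
  by rewrite /c; field; rewrite gt_eqF.
move=> h.
(* The term [w ^+ 2 / 2] is absorbed into the left-hand side. *)
have {}h : w ^+ 2 <= 2 * Q * (s ^ 2)%:R * F2 + s%:R * Q ^+ 2 * G2.
  move: h; have -> : 2 * Q * (s ^ 2)%:R * F2 = 2 * (Q * (s ^ 2)%:R * F2) by ring.
  by set X := Q * _ * F2; set Y := _ * G2; lra.
apply: le_trans h _; rewrite mulrDr /K.
have Q1 : 1 <= Q by rewrite exprn_ege1 // ler1n.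
have QE : (q ^ (2 * s))%:R = Q ^+ 2 by rewrite natrX mulnC exprM.
apply: lerD.
  rewrite ler_wpM2r // [in leRHS]natrM QE natrM mulrAC ler_wpM2l ?mulr_ge0 ?ler0n //.
  by rewrite expr2 ler_peMl // ltW.
rewrite ler_wpM2r // natrM QE ler_wpM2r ?sqr_ge0 // ler_nat.
by rewrite -mulnn mulnA leq_pmull // muln_gt0 s_gt0.
Qed.

End WeightedKovariSosTuran.

(** * Weighted walks *)

Section LogConvexSequences.
Local Open Scope ring_scope.
Variables (F : realFieldType) (a : nat -> F).
Hypotheses (a_ge0 : forall p, 0 <= a p)
  (a_logconvex : forall p, a p.+1 ^+ 2 <= a p * a p.+2).

(** Ratios of consecutive terms do not decrease. Division is avoided by multiplying with [a j.+1],
    which is positive unless [a j.+2] vanishes. *)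
Lemma logconvex_spread i j : (i <= j)%N -> a i.+1 * a j.+1 <= a i * a j.+2.
Proof.
elim: j => [|j IHj]; first by rewrite leqn0 => /eqP ->; rewrite -expr2.
rewrite leq_eqVlt => /orP[/eqP->|]; first by rewrite -expr2.
rewrite ltnS => /IHj {}IHj.
have [->|aj2] := eqVneq (a j.+2) 0; first by rewrite mulr0 mulr_ge0.
have aj1 : 0 < a j.+1.
  rewrite lt_def a_ge0 andbT; apply: contra_neq aj2 => aj1.
  apply/eqP; rewrite -sqrf_eq0 eq_le sqr_ge0 andbT.
  by apply: le_trans (a_logconvex _) _; rewrite aj1 mul0r.
rewrite -(ler_pM2r aj1) mulrAC; apply: le_trans (ler_wpM2r (a_ge0 _) IHj) _.
rewrite -!mulrA ler_wpM2l //; apply: le_trans (_ : a j.+2 ^+ 2 <= _) => //.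
by rewrite mulrC; apply: a_logconvex.
Qed.

(** The indices are spread until the smaller one is 1, not 0: the factor with index 1 will be the
    small one in [collision_le]. *)
Lemma logconvex_extremes p q : a p.+1 * a q.+1 <= a 1%N * a (p + q).+1.
Proof.
have half m n : (m <= n)%N -> a m.+1 * a n.+1 <= a 1%N * a (m + n).+1.
  elim: m n => [|m IHm] n mn; first by rewrite add0n.
  apply: le_trans (logconvex_spread _) _; first exact: mn.
  by rewrite addSnnS; apply: IHm; exact: leqW (ltnW mn).
case: (leqP p q) => [|/ltnW] /half //.
by rewrite [a p.+1 * _]mulrC addnC.
Qed.

(** Induction: after multiplication by [a p.+1 ^+ p], log-convexity raised to the power [p.+1]
    reduces the claim to the previous case. *)
Lemma logconvex_power p : a p ^+ p.+1 <= a 0%N * a p.+1 ^+ p.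
Proof.
elim: p => [|p IHp]; first by rewrite expr1 expr0 mulr1.
have [->|ap1] := eqVneq (a p.+1) 0; first by rewrite exprS mul0r mulr_ge0 ?exprn_ge0.
have {}ap1 : 0 < a p.+1 by rewrite lt_def ap1 a_ge0.
rewrite -(ler_pM2r (exprn_gt0 p ap1)) -exprD.
have -> : (p.+2 + p = 2 * p.+1)%N by lia.
rewrite exprM; apply: le_trans (_ : (a p * a p.+2) ^+ p.+1 <= _).
  by rewrite lerXn2r ?nnegrE ?sqr_ge0 ?mulr_ge0.
rewrite exprMn mulrAC; apply: ler_wpM2r => //; exact: exprn_ge0.
Qed.

End LogConvexSequences.

(** * Powers of a symmetric nonnegative matrix as weighted walk counts *)

Section Walks.
Local Open Scope ring_scope.
Variables (F : realFieldType) (T : finType) (N : T -> T -> F).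

(** The entry at [x], [y] of the [l]-th power of the matrix [N]. *)
Fixpoint walk l x y : F :=
  if l is l'.+1 then \sum_z N x z * walk l' z y else (x == y)%:R.

(* The sum of [Phi s] over the walks [x :: s] of length [l], each weighted by the
   product of the [N]-entries along it. *)
Fixpoint walksum l (Phi : seq T -> F) x : F :=
  if l is l'.+1 then \sum_y N x y * walksum l' (fun s => Phi (y :: s)) y
  else Phi [::].

Lemma walk0_suml (f : T -> F) x : \sum_z (x == z)%:R * f z = f x.
Proof.
rewrite (bigD1 x) //= eqxx mul1r big1 ?addr0 // => z.
by rewrite eq_sym => /negPf ->; rewrite mul0r.
Qed.

Lemma walkD a b x y : walk (a + b) x y = \sum_z walk a x z * walk b z y.
Proof.
elim: a x => [|a IHa] x /=; first by rewrite walk0_suml.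
under eq_bigr => z _ do rewrite IHa mulr_sumr.
rewrite exchange_big; apply: eq_bigr => z _; rewrite mulr_suml.
by apply: eq_bigr => t _; rewrite mulrA.
Qed.

Lemma walk1 x y : walk 1 x y = N x y.
Proof.
rewrite /= -[RHS](walk0_suml (N x)) /=.
rewrite (bigD1 y) //= eqxx mulr1 big1 ?addr0 => [|z /negPf zy].
  by rewrite walk0_suml.
by rewrite zy mulr0.
Qed.

Lemma walksumD a b Phi x :
  walksum (a + b) Phi x =
  walksum a (fun s => walksum b (fun t => Phi (s ++ t)) (last x s)) x.
Proof.
by elim: a Phi x => [|a IHa] Phi x //=; apply: eq_bigr => y _; rewrite IHa.
Qed.

Lemma eq_walksum l Phi Psi x : (forall s, size s = l -> Phi s = Psi s) ->
  walksum l Phi x = walksum l Psi x.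
Proof.
elim: l Phi Psi x => [|l IHl] Phi Psi x eqP /=; first exact: eqP.
apply: eq_bigr => y _; congr (_ * _); apply: IHl => s sl.
by apply: eqP; rewrite /= sl.
Qed.

Lemma walksum_last l (f : T -> F) x :
  walksum l (fun s => f (last x s)) x = \sum_y walk l x y * f y.
Proof.
elim: l x => [|l IHl] x /=; first by rewrite walk0_suml.
under eq_bigr => y _ do rewrite IHl mulr_sumr.
rewrite exchange_big; apply: eq_bigr => z _; rewrite mulr_suml.
by apply: eq_bigr => t _; rewrite mulrA.
Qed.

Lemma walksum_sum (J : finType) (P : pred J) l (Phi : J -> seq T -> F) x :
  walksum l (fun s => \sum_(j | P j) Phi j s) x = \sum_(j | P j) walksum l (Phi j) x.
Proof.
elim: l Phi x => [|l IHl] Phi x //=; rewrite exchange_big /=.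
by apply: eq_bigr => y _; rewrite IHl mulr_sumr.
Qed.

(** Cut at the two marked positions: the pieces have lengths [i], [l], [r], and summing over the
    starting point glues the last piece to the first. *)
Lemma sum_closed_walks_marked i l r (f : T -> T -> F) :
  \sum_x walksum (i + (l + r)) (fun s => (last x s == x)%:R *
      f (nth x (x :: s) i) (nth x (x :: s) (i + l))) x =
  \sum_y \sum_z f y z * (walk l y z * walk (r + i) z y).
Proof.
have step x : walksum (i + (l + r)) (fun s => (last x s == x)%:R *
      f (nth x (x :: s) i) (nth x (x :: s) (i + l))) x =
    \sum_y walk i x y * \sum_z walk l y z * (walk r z x * f y z).
  rewrite walksumD -walksum_last; apply: eq_walksum => s1 s1i.
  rewrite walksumD -walksum_last; apply: eq_walksum => s2 s2l.
  rewrite (_ : walk r _ x * _ = \sum_t walk r (last (last x s1) s2) t *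
     ((t == x)%:R * f (last x s1) (last (last x s1) s2))); last first.
    rewrite (bigD1 x) //= eqxx mul1r big1 ?addr0 // => t /negPf ->.
    by rewrite mul0r mulr0.
  rewrite -walksum_last; apply: eq_walksum => s3 s3r.
  rewrite !last_cat catA -!cat_cons; congr (_ * f _ _).
    by rewrite !nth_cat /= size_cat s1i ltnS leq_addr ltnSn -s1i nth_last.
  by rewrite nth_cat /= size_cat s1i s2l ltnSn -s1i -s2l -size_cat nth_last /= last_cat.
under eq_bigr => x _ do rewrite step.
rewrite exchange_big /=; apply: eq_bigr => y _.
under eq_bigr => x _ do rewrite mulr_sumr.
rewrite exchange_big /=; apply: eq_bigr => z _.
rewrite walkD !mulr_sumr; apply: eq_bigr => x _; ring.
Qed.

Hypothesis N_ge0 : forall x y, 0 <= N x y.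

Lemma walk_ge0 l x y : 0 <= walk l x y.
Proof.
elim: l x => [|l IHl] x /=; first exact: ler0n.
by apply: sumr_ge0 => z _; rewrite mulr_ge0.
Qed.

Lemma ler_walksum l Phi Psi x :
  (forall s, size s = l -> path (fun y z => N y z != 0) x s -> Phi s <= Psi s) ->
  walksum l Phi x <= walksum l Psi x.
Proof.
elim: l Phi Psi x => [|l IHl] Phi Psi x leP /=; first exact: leP.
apply: ler_sum => y _; have [->|Nxy] := eqVneq (N x y) 0; first by rewrite !mul0r.
apply: ler_wpM2l => //; apply: IHl => s sl ps.
by apply: leP; rewrite /= ?sl // Nxy.
Qed.

Hypothesis N_sym : forall x y, N x y = N y x.

Lemma walk_sym l x y : walk l x y = walk l y x.
Proof.
elim: l x y => [|l IHl] x y; first by rewrite /= eq_sym.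
rewrite -[in RHS]addn1 walkD [LHS]/=; apply: eq_bigr => z _.
by rewrite walk1 IHl N_sym mulrC.
Qed.

Definition loop p x := walk (p + p) x x.

Lemma loopE p x : loop p x = \sum_y walk p x y ^+ 2.
Proof.
by rewrite /loop walkD; apply: eq_bigr => y _; rewrite [walk p y x]walk_sym -expr2.
Qed.

Lemma loop_ge0 p x : 0 <= loop p x.
Proof. exact: walk_ge0. Qed.

(** Split a closed walk of length [2 * p + 2] into pieces of lengths [p] and [p + 2] and apply
    Cauchy-Schwarz. *)
Lemma loop_logconvex p x : loop p.+1 x ^+ 2 <= loop p x * loop p.+2 x.
Proof.
rewrite !(loopE p, loopE p.+2) /loop.
have -> : (p.+1 + p.+1 = p + p.+2)%N by lia.
rewrite walkD; under eq_bigr => y _ do rewrite [walk p.+2 y x]walk_sym.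
exact: cauchy_schwarz.
Qed.

(** The trace of the matrix power of exponent [2 * p], not [p]. *)
Definition trace p := \sum_x loop p x.

Lemma trace_ge0 p : 0 <= trace p.
Proof. by apply: sumr_ge0 => x _; apply: loop_ge0. Qed.

Lemma traceE p : trace p = \sum_(u : T * T) walk p u.1 u.2 ^+ 2.
Proof.
by rewrite -(pair_bigA _ (fun x y => walk p x y ^+ 2)); apply: eq_bigr => x _; apply: loopE.
Qed.

Lemma trace_logconvex p : trace p.+1 ^+ 2 <= trace p * trace p.+2.
Proof.
rewrite !(traceE p, traceE p.+2).
suff -> : trace p.+1 = \sum_(u : T * T) walk p u.1 u.2 * walk p.+2 u.1 u.2.
  exact: cauchy_schwarz.
rewrite -(pair_bigA _ (fun x y => walk p x y * walk p.+2 x y)); apply: eq_bigr => x _.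
rewrite /loop; have -> : (p.+1 + p.+1 = p + p.+2)%N by lia.
by rewrite walkD; apply: eq_bigr => y _; rewrite [walk p.+2 y x]walk_sym.
Qed.

Lemma trace0 : trace 0 = #|T|%:R.
Proof. by rewrite /trace /loop /= (eq_bigr (fun=> 1)) ?sumr_const // => x; rewrite eqxx. Qed.

(** A fixed vector of [N] is fixed by its powers; Cauchy-Schwarz in row [x] gives
    [v x ^+ 2 <= loop k x * \sum_y v y ^+ 2], and summing over [x] suffices. *)
Lemma trace_ge1 k (v : T -> F) : (forall x, \sum_y N x y * v y = v x) ->
  0 < \sum_x v x ^+ 2 -> 1 <= trace k.
Proof.
move=> Nv vp; have Wv l x : \sum_y walk l x y * v y = v x.
  elim: l x => [|l IHl] x; first exact: walk0_suml.
  rewrite -[RHS]Nv -[in RHS](eq_bigr _ (fun y _ => congr1 ( *%R (N x y)) (IHl y))).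
  under [in RHS]eq_bigr => y _ do rewrite mulr_sumr.
  rewrite exchange_big /=; apply: eq_bigr => y _; rewrite mulr_suml.
  by apply: eq_bigr => z _; rewrite mulrA.
rewrite -(ler_pM2r vp) mul1r mulr_suml; apply: ler_sum => x _.
by rewrite -{1}(Wv k x) loopE; apply: cauchy_schwarz.
Qed.

(* Weighted count of the pairs of walks of length [k] with common endpoints
   that meet after [p] steps. *)
Definition collision k p := \sum_x \sum_z \sum_y (walk p x y * walk (k - p) y z) ^+ 2.

(** Summing over the endpoints first leaves [loop p y * loop (k - p) y], which log-convexity bounds
    by [loop 1 y * loop k.-1 y]. *)
Lemma collision_le (eps : F) k p : (0 < p < k)%N ->
  (forall x, \sum_y N x y ^+ 2 <= eps) -> collision k p <= eps * trace k.-1.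
Proof.
move=> /andP[p0 pk] Neps.
have -> : collision k p = \sum_y loop p y * loop (k - p) y.
  rewrite /collision; under eq_bigr => x _ do rewrite exchange_big.
  rewrite exchange_big /=; apply: eq_bigr => y _; rewrite !loopE mulr_sum2.
  by apply: eq_bigr => x _; apply: eq_bigr => z _; rewrite exprMn [walk p x y]walk_sym.
rewrite mulr_sumr; apply: ler_sum => y _.
apply: le_trans (_ : loop 1 y * loop k.-1 y <= _).
  have := logconvex_extremes (loop_ge0^~ y) (loop_logconvex^~ y) p.-1 (k - p).-1.
  by rewrite !prednK ?subn_gt0 //; congr (_ <= _ * loop _ y); lia.
apply: ler_wpM2r; first exact: loop_ge0.
by rewrite loopE; under eq_bigr => z _ do rewrite walk1.
Qed.

(** Compare [k]-th powers: [trace k.-1 ^+ k <= #|T|%:R * trace k ^+ k.-1] by [logconvex_power], and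
    one more factor [trace k >= 1] is free. *)
Lemma trace_pred_le (eps c : F) k : (0 < k)%N -> 0 <= eps -> 0 < c ->
  (c * eps) ^+ k * #|T|%:R <= 1 -> 1 <= trace k ->
  eps * trace k.-1 <= c^-1 * trace k.
Proof.
move=> k0 e0 c0 h t1.
have t0 : 0 <= trace k by apply: le_trans t1.
rewrite ler_pdivlMl // mulrA.
have ce0 : 0 <= c * eps by rewrite mulr_ge0 // ltW.
rewrite -(@ler_pXn2r _ k) ?nnegrE ?(mulr_ge0 ce0) ?trace_ge0 //.
have := logconvex_power trace_ge0 trace_logconvex k.-1; rewrite prednK // trace0 => pw.
rewrite exprMn; apply: le_trans (ler_wpM2l _ pw) _; first exact: exprn_ge0.
rewrite mulrA; apply: le_trans (ler_wpM2r _ h) _; first exact: exprn_ge0.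
by rewrite mul1r -[X in _ <= _ ^+ X](prednK k0) exprS ler_peMl ?exprn_ge0.
Qed.

End Walks.

(** * Closed walks with two marked positions, and the union bound *)

Section MarkedClosedWalks.
Local Open Scope ring_scope.
Variables (F : realFieldType) (T : finType) (N : T -> T -> F).
Hypotheses (N_ge0 : forall x y, 0 <= N x y) (N_sym : forall x y, N x y = N y x).
Local Notation walk := (walk N).

(* Weighted count of the closed walks of length [2 * k] whose vertices at two
   fixed positions at distance [l] are related by [r]. *)
Definition marked k (r : rel T) l :=
  \sum_y \sum_z (r y z)%:R * (walk l y z * walk (2 * k - l) z y).

(* Cut the closed walk at the vertex preceding the first marked one and at its
   antipode: for fixed cut points the two marked vertices become independent,
   with the weights [f] and [g] of equal mass, and the sums of [f ^+ 2] and
   [g ^+ 2] count collisions. *)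
Lemma marked_le (r : rel T) (theta K : F) k l : (1 < l <= k)%N ->
  (forall (f g : T -> F) w, (forall x, 0 <= f x) -> (forall x, 0 <= g x) ->
     \sum_x f x = w -> \sum_x g x = w ->
     \sum_x \sum_y f x * g y * (r x y)%:R <=
       theta * w ^+ 2 + K * (\sum_x f x ^+ 2 + \sum_x g x ^+ 2)) ->
  marked k r l <= theta * trace N k + K * (collision N k 1 + collision N k l.-1).
Proof.
move=> /andP[l1 lk] rP.
(* The cut point [x] is the neighbour of [y] on the arc of length [l] from [y] to [z]; its antipode
   [t] lies on the other arc. Both weights have total mass [walk k x t]. *)
pose f x t y := walk 1 x y * walk (k - 1) y t.
pose g x t z := walk l.-1 x z * walk (k - l.-1) z t.
have -> : marked k r l = \sum_x \sum_t \sum_y \sum_z f x t y * g x t z * (r y z)%:R.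
  transitivity (\sum_y \sum_z \sum_x \sum_t f x t y * g x t z * (r y z)%:R).
    apply: eq_bigr => y _; apply: eq_bigr => z _.
    have -> : (2 * k - l = (k - l.-1) + (k - 1))%N by lia.
    rewrite -{1}(prednK (ltnW l1)) -add1n !walkD mulr_sum2 mulr_sumr.
    apply: eq_bigr => x _; rewrite mulr_sumr; apply: eq_bigr => t _.
    by rewrite /f /g (walk_sym N_sym 1 y x) (walk_sym N_sym (k - 1) t y); ring.
  under eq_bigr => y _ do rewrite exchange_big.
  rewrite exchange_big; apply: eq_bigr => x _ /=.
  under eq_bigr => y _ do rewrite exchange_big.
  by rewrite exchange_big.
have -> : trace N k = \sum_x \sum_t walk k x t ^+ 2.
  by apply: eq_bigr => x _; apply: loopE.
rewrite /collision -big_split mulr_sumr mulr_sumr -big_split /=.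
apply: ler_sum => x _; rewrite -big_split mulr_sumr mulr_sumr -big_split /=.
apply: ler_sum => t _; apply: rP => [y|y||].
- by rewrite mulr_ge0 // walk_ge0.
- by rewrite mulr_ge0 // walk_ge0.
- by rewrite /f -walkD subnKC // (leq_trans _ lk) // ltnW.
- by rewrite /g -walkD subnKC // (leq_trans _ lk) // leq_pred.
Qed.

Lemma marked_rev (r : rel T) k l : symmetric r -> (l <= 2 * k)%N ->
  marked k r (2 * k - l) = marked k r l.
Proof.
move=> r_sym l2k; rewrite /marked subKn // exchange_big.
by apply: eq_bigr => y _; apply: eq_bigr => z _; rewrite r_sym [walk _ z y * _]mulrC.
Qed.

(** Rotating a closed walk by one step exchanges starting points in [A] and outside [A]. *)
Lemma trace_half k (A : {set T}) : (0 < k)%N ->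
  (forall x y, N x y != 0 -> (x \in A) != (y \in A)) ->
  \sum_(x in A) loop N k x = trace N k / 2.
Proof.
move=> k0 bip.
suff AC : \sum_(x in A) loop N k x = \sum_(x in ~: A) loop N k x.
  have : trace N k = \sum_(x in A) loop N k x + \sum_(x in ~: A) loop N k x.
    rewrite /trace (bigID (mem A)) /=; congr (_ + _).
    by apply: eq_bigl => x; rewrite inE.
  by rewrite -AC => ->; field.
have loopN x : loop N k x = \sum_y N x y * walk (k + k).-1 y x.
  by rewrite /loop -{1}(prednK (_ : 0 < k + k)%N) // addn_gt0 k0.
have split (B : {set T}) : (forall x y, N x y != 0 -> (x \in B) != (y \in B)) ->
  \sum_(x in B) loop N k x = \sum_(x in B) \sum_(y in ~: B) N x y * walk (k + k).-1 y x.
  move=> bipB; apply: eq_bigr => x xB; rewrite loopN [RHS]big_mkcond.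
  apply: eq_bigr => y _; rewrite inE; case: ifPn => // /negbNE yB.
  by have [->|/bipB] := eqVneq (N x y) 0; rewrite ?mul0r // xB yB.
rewrite !split // ?setCK => [|x y /bip]; last by rewrite !inE; do 2 case: (_ \in A).
rewrite exchange_big; apply: eq_bigr => y _; apply: eq_bigr => x _.
by rewrite N_sym (walk_sym N_sym).
Qed.

(** Ordered pairs of positions that are not cyclically consecutive; the upper bound excludes only
    the first position paired with the last. *)
Definition separated m (p : 'I_m * 'I_m) := (p.1.+1 < p.2 <= p.1 + (m - 2))%N.

(** Closed walks from [A] carry half the trace, each separated pair spoils at most
    [beta * trace N k], and there are at most [(2 * k) ^ 2] pairs. *)
Lemma good_closed_walk k (A : {set T}) (r : rel T) (beta : F) :
  (1 < k)%N -> symmetric r ->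
  (forall x y, N x y != 0 -> (x \in A) != (y \in A)) ->
  (forall l, (1 < l <= k)%N -> marked k r l <= beta * trace N k) ->
  0 < trace N k -> ((2 * k) ^ 2)%:R * beta < 2^-1 ->
  exists x s, [/\ x \in A, size s = (2 * k)%N, path (fun y z => N y z != 0) x s,
    last x s = x & forall p : 'I_(2 * k) * 'I_(2 * k), separated p ->
      ~~ r (nth x (x :: s) p.1) (nth x (x :: s) p.2)].
Proof.
move=> k1 r_sym bip mk t0 small; have k0 := ltnW k1.
case: (boolP [exists x in A, exists s : (2 * k).-tuple T,
   [&& path (fun y z => N y z != 0) x s, last x s == x &
     [forall p : 'I_(2 * k) * 'I_(2 * k), separated p ==>
       ~~ r (nth x (x :: s) p.1) (nth x (x :: s) p.2)]]]).
  move=> /exists_inP[x xA /existsP[s /and3P[ps /eqP ls /forallP sP]]].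
  by exists x, s; split; rewrite ?size_tuple // => p; apply/implyP.
move=> /exists_inPn none; exfalso.
have le : \sum_(x in A) loop N k x <= \sum_x \sum_(p : 'I_(2 * k) * 'I_(2 * k) | separated p)
    walksum N (2 * k) (fun s => (last x s == x)%:R *
      (r (nth x (x :: s) p.1) (nth x (x :: s) p.2))%:R) x.
  rewrite [leLHS]big_mkcond; apply: ler_sum => x _.
  rewrite -walksum_sum; case: ifPn => [xA|_]; last first.
    rewrite -[leLHS](_ : walksum N (2 * k) (fun=> 0) x = 0).
      apply: ler_walksum => // s _ _.
      by apply: sumr_ge0 => p _; rewrite mulr_ge0 ?ler0n.
    rewrite (walksum_last N (2 * k) (fun=> 0)) big1 // => y _.
    by rewrite mulr0.
  have -> : loop N k x = walksum N (2 * k) (fun s => (last x s == x)%:R) x.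
    rewrite (walksum_last N (2 * k) (fun y => (y == x)%:R)) (bigD1 x) //= eqxx mulr1.
    rewrite big1 ?addr0 ?mul2n -?addnn // => y /negPf ->; by rewrite mulr0.
  apply: ler_walksum => // s ss ps; case: eqP => ls; last first.
    by apply: sumr_ge0 => p _; rewrite mulr_ge0 ?ler0n.
  have := none x xA; rewrite negb_exists => /forallP/(_ (Tuple (introT eqP ss))) /=.
  rewrite ps ls eqxx /= negb_forall => /existsP[p]; rewrite negb_imply negbK => /andP[sp rp].
  rewrite (bigD1 p) //= rp mulr1 lerDl.
  by apply: sumr_ge0 => q _; rewrite mulr_ge0 ?ler0n.
move: le; rewrite trace_half // exchange_big /= => le.
suff h : \sum_(p : 'I_(2 * k) * 'I_(2 * k) | separated p) \sum_x
    walksum N (2 * k) (fun s => (last x s == x)%:R *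
      (r (nth x (x :: s) p.1) (nth x (x :: s) p.2))%:R) x
    <= ((2 * k) ^ 2)%:R * beta * trace N k.
  have := le_trans le h.
  by rewrite [trace N k / 2]mulrC ler_pM2r // leNgt small.
have beta0 : 0 <= beta * trace N k.
  apply: le_trans (mk 2 _); last by rewrite k1.
  by do 2 (apply: sumr_ge0 => ? _); rewrite !mulr_ge0 ?ler0n ?walk_ge0.
have each (p : 'I_(2 * k) * 'I_(2 * k)) : separated p -> \sum_x
    walksum N (2 * k) (fun s => (last x s == x)%:R *
      (r (nth x (x :: s) p.1) (nth x (x :: s) p.2))%:R) x <= beta * trace N k.
  case: p => i j /andP[/= ij ji]; have j2k := ltn_ord j.
  have := sum_closed_walks_marked N i (j - i) (2 * k - j) (fun y z => (r y z)%:R).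
  have -> : (i + (j - i + (2 * k - j)) = 2 * k)%N by lia.
  have -> : (i + (j - i) = j)%N by lia.
  have -> : (2 * k - j + i = 2 * k - (j - i))%N by lia.
  move=> ->; rewrite -/(marked k r (j - i)).
  (* When the arc from [i] to [j] is longer than [k], the complementary arc is used. *)
  have [jk|jk] := leqP (j - i) k; first by apply: mk; lia.
  by rewrite -marked_rev //; [apply: mk|]; lia.
apply: le_trans (ler_sum _ each) _; rewrite sumr_const -[_ *+ _]mulr_natl -mulrA.
apply: ler_wpM2r => //; rewrite ler_nat; apply: leq_trans (max_card _) _.
by rewrite card_prod card_ord.
Qed.

End MarkedClosedWalks.

(** * Induced cycles in graphs of large minimum degree *)

Section InducedCycles.
Variables (T : finType) (e : rel T) (A U : {set T}).
Hypothesis e_simple : simple_graph e.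

(** The bipartite graph stays a relation on all of [T]; vertices outside [U] are isolated. *)
Definition cross : rel T :=
  fun x y => [&& x \in U, y \in U, e x y & (x \in A) != (y \in A)].

Definition cross_degree x := #|[set y | cross x y]|.

Lemma cross_sym : symmetric cross.
Proof.
by case: e_simple => e_sym _ x y; rewrite /cross andbCA e_sym (eq_sym (x \in A)).
Qed.

(** The steps of the walk lie in [cross], but the excluded chords are those of [e], so the cycle is
    induced in the whole graph. Parity comes from each step changing sides. *)
Lemma induced_cycle_of_closed_walk k x (s : seq T) : 1 < k ->
  x \in A -> size s = 2 * k -> path cross x s -> last x s = x ->
  (forall p : 'I_(2 * k) * 'I_(2 * k), separated p ->
     ~~ (e (nth x (x :: s) p.1) (nth x (x :: s) p.2)
         || (nth x (x :: s) p.1 == nth x (x :: s) p.2))) ->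
  exists v : 'I_(2 * k) -> T,
    induced_cycle e v /\
    forall i : 'I_(2 * k), v i \in (if odd i then ~: A else A).
Proof.
case: e_simple => e_sym e_irr k1 xA ss /(pathP x) ps ls sP.
pose u n := nth x (x :: s) n.
have step n : n < 2 * k -> cross (u n) (u n.+1) by rewrite -ss => /ps.
have u2k : u (2 * k) = u 0 by rewrite /u -ss nth_last.
have parity n : n <= 2 * k -> (u n \in A) = ~~ odd n.
  elim: n => [|n IHn] n2k; first by rewrite xA.
  have /and4P[_ _ _] := step n n2k; rewrite IHn 1?ltnW //= negbK.
  by case: (odd n); case: (_ \in A).
have next (i j : 'I_(2 * k)) : j = i.+1 %% (2 * k) :> nat -> e (u i) (u j).
  move=> ->; have /and4P[_ _ ei _] := step i (ltn_ord i).
  have := ltn_ord i; rewrite leq_eqVlt => /orP[/eqP E|lt]; last by rewrite modn_small.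
  by move: ei; rewrite [in X in X -> _]E u2k E modnn.
have far (i j : 'I_(2 * k)) : i < j ->
    ~~ ((j == i.+1 %% (2 * k) :> nat) || (i == j.+1 %% (2 * k) :> nat)) ->
    ~~ (e (u i) (u j) || (u i == u j)).
  move=> ij nadj; apply: (sP (i, j)); rewrite /separated /=.
  have j2k := ltn_ord j; move: nadj.
  have i1 : i.+1 %% (2 * k) = i.+1 by rewrite modn_small //; lia.
  rewrite i1; have [E|lt] : j.+1 = 2 * k \/ j.+1 < 2 * k by lia.
    by rewrite E modnn; lia.
  by rewrite modn_small //; lia.
have far2 (i j : 'I_(2 * k)) : i != j ->
    ~~ ((j == i.+1 %% (2 * k) :> nat) || (i == j.+1 %% (2 * k) :> nat)) ->
    ~~ (e (u i) (u j) || (u i == u j)).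
  rewrite -val_eqE neq_ltn => /orP[|ji]; first exact: far.
  by move=> nadj; rewrite e_sym eq_sym; apply: far => //; rewrite orbC.
have adj (i j : 'I_(2 * k)) :
    e (u i) (u j) = ((j == i.+1 %% (2 * k) :> nat) || (i == j.+1 %% (2 * k) :> nat)).
  have [/orP[/eqP/next->//|/eqP/next]|] := boolP ((j == i.+1 %% _ :> nat) || _).
    by rewrite e_sym.
  have [<- _|ij /(far2 _ _ ij)] := eqVneq i j; first exact: e_irr.
  by case: (e _ _).
exists (fun i : 'I_(2 * k) => u i); split; last first.
  by move=> i; case: ifP => oi; rewrite ?inE parity ?oi // ltnW.
(* Equal vertices are not adjacent, so their positions are not consecutive, and then [far2]
   separates them. *)
split=> // i j uij; apply/eqP; apply: contraT => ij.
have := adj i j; rewrite uij e_irr => /esym/negbT nadj.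
by have := far2 _ _ ij nadj; rewrite uij eqxx orbT.
Qed.

Local Open Scope ring_scope.
Variables (F : rcfType) (d : nat).
Hypotheses (d_gt0 : (0 < d)%N) (U_gt0 : (0 < #|U|)%N)
  (deg_ge : forall x, x \in U -> (d <= cross_degree x)%N).

(* With the normalised adjacency matrix a lower bound on the degrees suffices:
   no upper bound, hence no regularisation of the graph, is needed. *)
Definition weight x y : F :=
  (cross x y)%:R / (Num.sqrt (cross_degree x)%:R * Num.sqrt (cross_degree y)%:R).

Lemma weight_ge0 x y : 0 <= weight x y.
Proof. by rewrite divr_ge0 ?ler0n // mulr_ge0 ?sqrtr_ge0. Qed.

Lemma weight_sym x y : weight x y = weight y x.
Proof. by rewrite /weight cross_sym [_ * Num.sqrt _]mulrC. Qed.

Lemma weight_neq0 x y : weight x y != 0 -> cross x y.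
Proof. by apply: contraNT => /negPf nxy; rewrite /weight nxy mul0r. Qed.

Lemma sum_cross x : \sum_y (cross x y)%:R = (cross_degree x)%:R :> F.
Proof.
rewrite /cross_degree -sum1_card natr_sum [RHS]big_mkcond /=.
by apply: eq_bigr => y _; rewrite inE; case: cross.
Qed.

Lemma cross_degree_gt0 x y : cross x y -> 0 < (cross_degree x)%:R :> F.
Proof. by move=> xy; rewrite ltr0n card_gt0; apply/set0Pn; exists y; rewrite inE. Qed.

(** Row [x] has [cross_degree x] nonzero entries, each with square at most the inverse of
    [cross_degree x * d]. *)
Lemma sum_weight_sqr_le x : \sum_y weight x y ^+ 2 <= d%:R^-1.
Proof.
apply: le_trans (_ : \sum_y (cross x y)%:R * ((cross_degree x)%:R^-1 / d%:R) <= _).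
  apply: ler_sum => y _; rewrite /weight; case: (boolP (cross x y)) => xy; last first.
    by rewrite !mul0r expr0n.
  rewrite !mul1r exprVn exprMn !sqr_sqrtr ?ler0n // invfM.
  rewrite ler_wpM2l ?invr_ge0 ?ler0n // lef_pV2 ?posrE ?ltr0n ?ler_nat //.
    by rewrite deg_ge //; case/and4P: xy.
  by have := cross_degree_gt0 (etrans (cross_sym y x) xy); rewrite ltr0n.
rewrite -mulr_suml sum_cross mulrA; have [->|nz] := eqVneq (cross_degree x)%:R (0 : F).
  by rewrite !mul0r invr_ge0 ler0n.
by rewrite divff // mul1r.
Qed.

(** The square roots of the degrees form the fixed vector required by [trace_ge1]. *)
Lemma sum_weight_sqrt x :
  \sum_y weight x y * Num.sqrt (cross_degree y)%:R = Num.sqrt (cross_degree x)%:R.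
Proof.
transitivity (\sum_y (cross x y)%:R / Num.sqrt (cross_degree x)%:R : F).
  apply: eq_bigr => y _; rewrite /weight; case: (boolP (cross x y)) => xy; last first.
    by rewrite !mul0r.
  have dy : Num.sqrt (cross_degree y)%:R != 0 :> F.
    by rewrite gt_eqF // sqrtr_gt0; apply: cross_degree_gt0 (etrans (cross_sym y x) xy).
  have dx : Num.sqrt (cross_degree x)%:R != 0 :> F.
    by rewrite gt_eqF // sqrtr_gt0; apply: cross_degree_gt0 xy.
  by field; rewrite dx dy.
rewrite -mulr_suml sum_cross -{1}[(cross_degree x)%:R](@sqr_sqrtr F) ?ler0n //.
have [->|nz] := eqVneq (Num.sqrt (cross_degree x)%:R) (0 : F).
  by rewrite expr0n mul0r.
by rewrite expr2 mulfK.
Qed.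

Lemma trace_weight_ge1 k : 1 <= trace weight k.
Proof.
apply: (trace_ge1 weight_sym k sum_weight_sqrt).
have /card_gt0P[x xU] := U_gt0.
rewrite (bigD1 x) //= ltr_wpDr ?sumr_ge0 // => [y _|]; first exact: sqr_ge0.
by rewrite sqr_sqrtr ?ler0n // ltr0n (leq_trans d_gt0) ?deg_ge.
Qed.

End InducedCycles.

(* [weighted_kst] is applied with [q := 16 * k ^ 2], so that a union bound over
   fewer than [4 * k ^ 2] pairs of positions loses a quarter of the trace; the
   collisions lose less than another quarter. *)
Definition kst_constant k s := 2 * s ^ 2 * (16 * k ^ 2) ^ (2 * s).

(** Exceeds [32 * k ^ 2 * (K + 1)], with [K] the [kst_constant], so that [4 * k ^ 2] pairs with two
    collision terms each lose less than a quarter of the trace. The summand 1 beside [K] pays for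
    coinciding vertices. *)
Definition density_constant k s := (32 * k ^ 2 * (kst_constant k s).+1).+1.

Lemma density_constant_small (F : realFieldType) k s : 0 < k ->
  (((2 * k) ^ 2)%:R * ((16 * k ^ 2)%:R^-1
    + (kst_constant k s).+1%:R * (2 / (density_constant k s)%:R)) < 2^-1 :> F)%R.
Proof.
move=> k0; have k0F : (k%:R != 0 :> F)%R by rewrite pnatr_eq0 -lt0n.
rewrite mulrDr; have -> : (((2 * k) ^ 2)%:R * (16 * k ^ 2)%:R^-1 = 4^-1 :> F)%R.
  by rewrite expnMn !natrM ?natrX; field; rewrite k0F.
suff h : (((2 * k) ^ 2)%:R * ((kst_constant k s).+1%:R * (2 / (density_constant k s)%:R))
     < 4^-1 :> F)%R.
  by move: h; set X := (_ * (_ * _))%R; lra.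
rewrite !mulrA ltr_pdivrMr ?ltr0n // ltr_pdivlMl // -!natrM ltr_nat /density_constant.
rewrite ltnS expnMn; nia.
Qed.

(** * Induced cycles from a minimum degree bound *)

Section MinimumDegree.
Variable F : rcfType.
Variables (T : finType) (e : rel T) (A : {set T}) (k s : nat).
Hypotheses (e_simple : simple_graph e) (noK : ~ has_Kss e s) (k_gt1 : 1 < k).

Lemma induced_cycle_of_min_degree (U : {set T}) d :
  0 < #|U| -> (forall x, x \in U -> d <= cross_degree e A U x) ->
  density_constant k s ^ k * #|T| <= d ^ k ->
  exists v : 'I_(2 * k) -> T,
    induced_cycle e v /\
    forall i : 'I_(2 * k), v i \in (if odd i then ~: A else A).
Proof.
move=> U0 deg_ge dk; have k0 := ltnW k_gt1.
have T0 : 0 < #|T| by apply: leq_trans U0 (max_card _).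
have d0 : 0 < d.
  rewrite -(@ltn_exp2r 0 d k) // exp0n //; apply: leq_trans dk.
  by rewrite muln_gt0 expn_gt0.
case: (e_simple) => e_sym e_irr.
pose N := weight e A U F.
(* Equality is included so that avoiding [r] also makes the cycle injective. *)
pose r : rel T := fun x y => e x y || (x == y).
have N0 : forall x y, (0 <= N x y)%R by apply: weight_ge0.
have Ns : forall x y, N x y = N y x by apply: weight_sym.
have t1 := trace_weight_ge1 e_simple F d0 U0 deg_ge k.
have [||||||x [w [xA sw pw lw wP]]] :=
  @good_closed_walk _ _ N N0 Ns k A r
    ((16 * k ^ 2)%:R^-1 + (kst_constant k s).+1%:R * (2 / (density_constant k s)%:R))%R.
- exact: k_gt1.
- by move=> x y; rewrite /r e_sym eq_sym.
- by move=> x y /weight_neq0 /and4P[].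
- move=> l lk; have /andP[l1 lk'] := lk.
  (* With [eps] the inverse of [d] and [c] the density constant, the smallness condition of
     [trace_pred_le] is exactly the assumed bound on [d ^ k]. *)
  have col p : 0 < p < k -> (collision N k p <= (density_constant k s)%:R^-1 * trace N k)%R.
    move=> pk; apply: le_trans (collision_le N0 Ns pk _) _.
      exact: (sum_weight_sqr_le e_simple F d0 deg_ge).
    apply: trace_pred_le => //; rewrite ?invr_ge0 ?ler0n ?ltr0n //.
    rewrite expr_div_n mulrAC ler_pdivrMr ?exprn_gt0 ?ltr0n // mul1r.
    by rewrite -!natrX -natrM ler_nat.
  apply: le_trans (marked_le (theta := (16 * k ^ 2)%:R^-1%R)
    (K := (kst_constant k s).+1%:R) N0 Ns lk _) _; last first.
    rewrite [leRHS]mulrDl lerD2l -[leRHS]mulrA ler_wpM2l ?ler0n //.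
    rewrite -mulrA mulr_natl mulr2n; apply: lerD; apply: col; first by rewrite k_gt1.
    by rewrite -ltnS prednK ?(ltnW l1) // l1.
  move=> f g w f0 g0 fw gw.
  have q0 : 0 < 16 * k ^ 2 by rewrite muln_gt0 expn_gt0 k0.
  have kst := weighted_kst e_irr noK q0 f0 g0 fw gw.
  have diag : (\sum_x \sum_y f x * g y * (x == y)%:R
      <= \sum_x f x ^+ 2 + \sum_x g x ^+ 2 :> F)%R.
    rewrite -big_split /=; apply: ler_sum => x _.
    rewrite (bigD1 x) //= eqxx mulr1 big1 ?addr0 => [|y]; last first.
      by rewrite eq_sym => /negPf ->; rewrite mulr0.
    have := sqr_ge0 (f x - g x)%R; have := sqr_ge0 (f x + g x)%R; lra.
  apply: le_trans (_ : (\sum_x \sum_y f x * g y * (e x y)%:R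
      + \sum_x \sum_y f x * g y * (x == y)%:R <= _)%R); last first.
    apply: le_trans (lerD kst diag) _.
    by rewrite -addrA lerD2l -/(kst_constant k s) -natr1 mulrDl mul1r.
  rewrite -big_split; apply: ler_sum => x _; rewrite -big_split.
  apply: ler_sum => y _; rewrite /= -mulrDr ler_wpM2l ?mulr_ge0 // /r -natrD ler_nat.
  by case: (e x y); case: (x == y).
- by apply: lt_le_trans t1; rewrite ltr01.
- exact: density_constant_small.
apply: (induced_cycle_of_closed_walk (U := U) e_simple k_gt1 xA sw _ lw wP).
by apply: sub_path pw => y z; apply: weight_neq0.
Qed.

End MinimumDegree.

(** * A vertex subset of large minimum degree *)

Section MinimalSubset.
Variables (T : finType) (e : rel T) (A : {set T}).
Hypothesis e_simple : simple_graph e.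

(** A degree sum, hence twice the number of edges of [cross] on [U]. *)
Definition cross_edges (U : {set T}) := \sum_(x in U) cross_degree e A U x.

Lemma cross_edgesD1 (U : {set T}) x : x \in U ->
  cross_edges U = cross_edges (U :\ x) + 2 * cross_degree e A U x.
Proof.
move=> xU; rewrite /cross_edges (big_setD1 x xU) /=.
have degE y : y \in U :\ x ->
    cross_degree e A U y = cross_degree e A (U :\ x) y + cross e A U x y.
  move=> yUx; rewrite /cross_degree (cardsD1 x) inE (cross_sym _ _ e_simple) addnC.
  congr (_ + _); apply: eq_card => z; rewrite !inE /cross yUx !inE.
  by move: yUx; rewrite !inE => /andP[_ ->]; case: eqP.
rewrite (eq_bigr _ degE) big_split /= addnCA mul2n -addnn; congr (_ + (_ + _)).
rewrite /cross_degree -sum1_card [RHS]big_mkcond [LHS]big_mkcond /=.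
apply: eq_bigr => y _; rewrite !inE /cross.
case: e_simple => _ e_irr; have [->|_] := eqVneq y x; first by rewrite e_irr !andbF.
by case: (y \in U); rewrite ?andbF //=; case: (_ && _).
Qed.

Lemma edges_between_le : edges_between e A (~: A) <= cross_edges setT.
Proof.
rewrite /edges_between /cross_edges.
rewrite (eq_bigl predT) => [|x]; last by rewrite inE.
rewrite /cross_degree; under eq_bigr => x _ do rewrite -sum1_card big_mkcond.
rewrite pair_big -sum1_card big_mkcond /=; apply: leq_sum => -[x y] _ /=.
rewrite !inE /cross !inE /=; case: (x \in A) => //=.
by case: (y \in A); case: (e x y).
Qed.

Lemma exists_min_degree_subset : 0 < cross_edges setT ->
  exists U : {set T}, 0 < #|U| /\
    forall x, x \in U -> cross_edges setT < 2 * #|T| * cross_degree e A U x.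
Proof.
move=> E0; set E := cross_edges setT.
(* The predecessor makes the condition strict for [setT] yet false for the empty set. Comparing a
   minimal dense [U] with [U :\ x] isolates the degree of [x]. *)
pose dense (U : {set T}) := E * #|U|.-1 < #|T| * cross_edges U.
have denseT : dense setT.
  have T0 : 0 < #|T|.
    rewrite lt0n; apply: contraTneq E0 => T0; rewrite -leqNgt leqn0 /cross_edges big1 // => x _.
    by have := max_card (pred1 x); rewrite card1 T0.
  by rewrite /dense -/E cardsT mulnC ltn_pmul2r // prednK.
have [U /minsetP[dU minU] _] := minset_exists denseT.
have cross0 : cross_edges set0 = 0 by rewrite /cross_edges big_set0.
have U0 : 0 < #|U|.
  rewrite card_gt0; apply: contraTneq dU => ->.
  by rewrite /dense cross0 muln0 ltn0.
exists U; split=> // x xU.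
have ndense : ~~ dense (U :\ x).
  apply/negP => /minU/(_ (subD1set _ _)) UE.
  by move: xU; rewrite -UE !inE eqxx.
move: dU ndense; rewrite /dense -leqNgt (cross_edgesD1 xU) (cardsD1 x U) xU /=.
set m := #|U :\ x|; set c := cross_edges _; set dx := cross_degree _ _ _ _.
(* For a single vertex the truncated predecessor breaks the comparison, but then there are no edges
   and [U] is not dense. *)
have [m0|m0] := posnP m.
  have -> : c = 0 by rewrite /c (cards0_eq m0) cross0.
  have -> : dx = 0.
    apply/eqP; rewrite cards_eq0; apply/eqP/setP => y; rewrite !inE /cross.
    have /setP/(_ y) := cards0_eq m0; rewrite !inE.
    case: e_simple => _ e_irr; case: eqP => [->|_ /= ->]; last by rewrite andbF.
    by rewrite e_irr !andbF.
  by rewrite m0 !muln0.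
by nia.
Qed.

End MinimalSubset.

(* Real exponents and the conclusion *)
From Stdlib Require Import Reals Lra.

Lemma expn_INR (m n : nat) : INR (expn m n) = (INR m ^ n)%R.
Proof. by elim: n => [|n IHn] //; rewrite expnS mult_INR IHn. Qed.

Lemma Rpower_root_pow (x : R) (k : nat) : (0 < x)%R -> 0 < k ->
  (Rpower x (1 / INR k) ^ k)%R = x.
Proof.
move=> x0 k0; rewrite -Rpower_pow; last exact: exp_pos.
rewrite Rpower_mult Rdiv_1_l Rinv_l ?Rpower_1 //.
by apply: not_0_INR => k00; rewrite k00 in k0.
Qed.

(** Cancelling [2 * n] gives [D * t <= d] with [t] the [k]-th root of [n]; raising to the power [k]
    returns to integers. *)
Lemma root_bound_pow (D n d k E : nat) : 0 < k -> 0 < n ->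
  (INR (2 * D) * Rpower (INR n) (1 + 1 / INR k) <= INR E)%R ->
  E <= 2 * n * d -> expn D k * n <= expn d k.
Proof.
move=> k0 n0 h1 /ssrnat.leP/le_INR; rewrite !mult_INR => h2.
have n0' : (0 < INR n)%R by apply: lt_0_INR; apply/ssrnat.ltP.
move: h1; rewrite Rpower_plus Rpower_1 // mult_INR.
set t := Rpower _ _ => h1.
have t0 : (0 < t)%R by apply: exp_pos.
have I2 : INR 2 = 2%R by [].
have h : (INR D * t <= INR d)%R.
  apply: (Rmult_le_reg_l (2 * INR n)); first Lra.lra.
  by rewrite I2 in h1 h2; Lra.lra.
apply/ssrnat.leP/INR_le; rewrite mult_INR !expn_INR -[INR n](Rpower_root_pow n0' k0) -/t -Rpow_mult_distr.
apply: pow_incr; split=> //; apply: Rmult_le_pos; [exact: pos_INR|exact: Rlt_le].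
Qed.

Theorem theorem4p1 (k s : nat) (hk : 2 <= k) (hs : 2 <= s) :
  exists C : R, (0 < C)%R /\
  forall (T : finType) (e : rel T) (A : {set T}),
    simple_graph e ->
    ~ has_Kss e s ->
    (C * Rpower (INR #|T|) (1 + 1 / INR k) <= INR (edges_between e A (~: A)))%R ->
    exists v : 'I_(2 * k) -> T,
      induced_cycle e v /\
      forall i : 'I_(2 * k), v i \in (if odd i then ~: A else A).
Proof.
(* The factor 2 matches the one in the bound [2 * #|T| * cross_degree e A U x] of
   [exists_min_degree_subset]. *)
exists (INR (2 * density_constant k s)); split; first exact/lt_0_INR/ssrnat.ltP.
move=> T e A e_simple noK many.
(* [Rpower] is an exponential, positive even when [T] is empty, so the hypothesis itself provides an
   edge. *)
have E0 : 0 < edges_between e A (~: A).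
  apply/ssrnat.ltP/INR_lt; apply: Rlt_le_trans many.
  by apply: Rmult_lt_0_compat; [exact/lt_0_INR/ssrnat.ltP|exact: exp_pos].
have le := edges_between_le e A.
have [U [U0 degU]] := exists_min_degree_subset e_simple (leq_trans E0 le).
have /card_gt0P[x0 x0U] := U0.
case: (arg_minnP (cross_degree e A U) x0U) => x xU minx.
apply: (induced_cycle_of_min_degree realalg e_simple noK hk U0 minx).
apply: root_bound_pow many _; first exact: ltnW.
  exact: leq_trans U0 (max_card _).
exact: leq_trans le (ltnW (degU x xU)).
Qed.
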